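(* Let $x$ be an irrational number, and let $0\le a_0<a_1<\cdots$ be a sequence of integers such that the sequence $(a_i x \bmod 1)_{i\ge 0}$ is monotonically increasing and converges to $1$. Let $A=\{a_0,a_1,\ldots\}$. Then for every positive integer $h$, \[ x\ast hA \simeq \omega^h, \] where $hA=\{b_1+\cdots+b_h : b_1,\ldots,b_h\in A\}$ is the $h$-fold sumset of $A$.
   Context: For a real number $x$ and a set $S\subseteq\mathbb{N}$, $x\ast S := \{xs \bmod 1 : s\in S\}\subseteq[0,1)$, ordered as a subset of the reals. $X\simeq\omega^h$ means the ordered set $X$ has order type the ordinal $\omega^h$ (ordinal exponentiation). *)

(* Defs.v *)
From mathcomp Require Import all_boot all_order all_algebra.
From mathcomp Require Import all_classical all_reals all_analysis.

Set Implicit Arguments.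
Unset Strict Implicit.
Unset Printing Implicit Defensive.

Import Order.TTheory GRing.Theory Num.Theory.
Import numFieldNormedType.Exports.

Local Open Scope classical_set_scope.
Local Open Scope ring_scope.

Definition mod1 (R : realType) (x : R) : R := x - (Num.floor x)%:~R.

Definition dilate_mod1 (R : realType) (x : R) (S : set nat) : set R :=
  [set mod1 (x * s%:R) | s in S].

(* The b i range independently over A: repetitions are allowed. *)
Definition hfold_sumset (h : nat) (A : set nat) : set nat :=
  [set (\sum_(i < h) b i)%N | b in [set b : 'I_h -> nat | forall i, A (b i)]].

(* Ordinals are represented by ordered types of that order type.  The ordinal
   product alpha * beta is the order type of beta copies of alpha, one after
   the other: the coordinate in beta is compared first.  The display d only
   selects notations. *)
Definition ordinal_mul (d d1 d2 : Order.disp_t)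
    (alpha : orderType d1) (beta : orderType d2) : orderType d :=
  (beta *lexi[d] alpha)%type.

(* omega ^ 0 = 1 and omega ^ (h + 1) = omega ^ h * omega. *)
Fixpoint omega_exp (h : nat) : orderType Order.OrdinalOrder.ord_display :=
  if h is h'.+1
  then ordinal_mul Order.OrdinalOrder.ord_display (omega_exp h') nat
  else 'I_1.

(* The mono condition makes f injective, hence an order isomorphism of T onto
   X with the order induced by R. *)
Definition has_order_type (R : realType) (d : Order.disp_t) (X : set R)
    (T : orderType d) : Prop :=
  exists2 f : T -> R, {mono f : u v / (u <= v)%O} & range f = X.

(* Main.v *)
Require Import Defs.
From mathcomp Require Import all_boot all_order all_algebra.
From mathcomp Require Import all_classical all_reals all_analysis.
From mathcomp Require Import lra.
Import Order.TTheory GRing.Theory Num.Theory.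
Import numFieldNormedType.Exports.
Local Open Scope classical_set_scope.
Local Open Scope ring_scope.

(* Write X_h for the dilate of hA.  If a sum of h + 1 terms of A has value below
   c < 1, one of its terms a_i has i bounded in terms of c, so the part of
   X_{h+1} below c is covered by finitely many translates of X_h.  Since
   omega ^ h is indivisible, finite unions of sets of type < omega ^ h again
   have type < omega ^ h; by induction X_h is well-ordered, of type
   < omega ^ (h + 1), and every proper initial segment of X_h has type
   < omega ^ h.  Conversely omega ^ h embeds in X_h: just below 1 no reduction
   mod 1 takes place, and one chooses each term much closer to 1 than the
   previous ones. *)

(** * The powers of omega: well-foundedness and indivisibility *)

Lemma omega_exp_lt (h n m : nat) (u v : omega_exp h) :
  ((n, u) < (m, v) :> omega_exp h.+1)%O = (n < m)%N || (n == m) && (u < v)%O.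
Proof.
rewrite (@ltxi_pair _ _ _ nat (omega_exp h)) !leEnat.
by case: ltngtP => //= ->; rewrite ?leqnn ?eqxx ?ltnn.
Qed.

Lemma omega_exp_inhabited (h : nat) : inhabited (omega_exp h).
Proof.
elim: h => [|h [u]]; first exact: (inhabits (ord0 : 'I_1)).
exact: (inhabits ((0%N, u) : omega_exp h.+1)).
Qed.

Lemma omega_exp_wf (h : nat) :
  well_founded (fun u v : omega_exp h => (u < v)%O).
Proof.
elim: h => [|h IH] /=.
  by move=> u; constructor => v; rewrite (ord1 u) (ord1 v) ltxx.
move=> [n u].
elim/ltn_ind: n u => n IHn u.
elim/(well_founded_ind IH): u => u IHu.
constructor => -[m v]; rewrite omega_exp_lt => /orP[lt_mn|/andP[/eqP-> lt_vu]].
  exact: IHn.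
exact: IHu.
Qed.

Lemma infinitely_often_subseq (P : set nat) :
  (forall m, exists2 n, (m <= n)%N & P n) ->
  exists2 k : nat -> nat, {homo k : i j / (i < j)%N} & forall i, P (k i).
Proof.
move=> Pinf.
have [f fP] : {f : nat -> nat & forall m, (m <= f m)%N /\ P (f m)}.
  apply: (@choice _ _ (fun m n => (m <= n)%N /\ P n)) => m.
  by have [n] := Pinf m; exists n.
pose k := fix k i := if i is i'.+1 then f (k i').+1 else f 0%N.
exists k; last by case=> [|i]; [have [] := fP 0%N | have [] := fP (k i).+1].
apply: (@homo_ltn _ k (fun i j => (i < j)%N) ltn_trans) => i.
by have [] := fP (k i).+1.
Qed.

(** By induction, each of the omega copies of omega ^ h contains a monochromatic copy of omega ^ h.
    One colour occurs for infinitely many of them, and these, taken in order, form omega ^ (h +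
    1). *)
Lemma omega_exp_indivisible (h : nat) (P : set (omega_exp h)) :
  exists b : bool, exists2 phi : omega_exp h -> omega_exp h,
    {homo phi : u v / (u < v)%O} & forall u, `[< P (phi u) >] = b.
Proof.
elim: h P => [|h IH] P.
  exists `[< P (ord0 : 'I_1) >]; exists id => // u.
  by rewrite (ord1 u).
have [b bP] := choice (fun n => IH [set u | P ((n, u) : omega_exp h.+1)]).
have [phi phiP] := choice (fun n => let: ex_intro2 f f1 f2 := bP n in
  ex_intro (fun f => {homo f : u v / (u < v)%O} /\ forall u,
    `[< P ((n, f u) : omega_exp h.+1) >] = b n) f (conj f1 f2)).
have [c cinf] : exists c, forall m, exists2 n, (m <= n)%N & b n = c.
  apply: contrapT => /forallNP nc.
  have /existsNP[m1 h1] := nc true; have /existsNP[m2 h2] := nc false.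
  case E : (b (maxn m1 m2)).
    by apply: h1; exists (maxn m1 m2); rewrite ?leq_maxl.
  by apply: h2; exists (maxn m1 m2); rewrite ?leq_maxr.
have [k k_incr kc] := infinitely_often_subseq [set n | b n = c] cinf.
exists c, (fun nu => (k nu.1, phi (k nu.1) nu.2) : omega_exp h.+1).
  move=> [n u] [m v]; rewrite !omega_exp_lt => /orP[lt_nm|/andP[/eqP-> lt_uv]].
    by rewrite /= k_incr.
  by rewrite /= eqxx (phiP _).1 ?orbT.
by move=> [n u] /=; rewrite (phiP _).2 kc.
Qed.

(** * Order types of sets of reals *)

Definition embeds (d : Order.disp_t) (T : orderType d) (R : realType)
    (S : set R) : Prop :=
  exists2 g : T -> R, {homo g : u v / (u < v)%O} & forall u, S (g u).

Definition well_ordered (R : realType) (S : set R) : Prop :=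
  forall V : set R, V `<=` S -> V !=set0 ->
    exists2 m, V m & forall v, V v -> m <= v.

(* For a well-ordered T of type alpha, this says that S has type < alpha. *)
Definition order_type_below (d : Order.disp_t) (T : orderType d)
    (R : realType) (S : set R) : Prop :=
  well_ordered R S /\ ~ embeds d T R S.

Lemma order_type_below_subset (d : Order.disp_t) (T : orderType d)
    (R : realType) (S S' : set R) :
  S `<=` S' -> order_type_below d T R S' -> order_type_below d T R S.
Proof.
move=> SS' [wS' nS']; split=> [V VS|[g g_incr gS]].
  by apply: wS'; apply: subset_trans SS'.
by apply: nS'; exists g => // u; apply: SS'.
Qed.

Lemma order_type_below_translate (d : Order.disp_t) (T : orderType d)
    (R : realType) (c : R) (S : set R) :
  order_type_below d T R S ->
  order_type_below d T R [set c + z | z in S].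
Proof.
move=> [wS nS]; split=> [V VS [v0 Vv0]|[g g_incr gS]].
  have [||m /= Vm mP] := wS [set z | V (c + z)].
  - by move=> z /VS[w Sw /addrI <-].
  - by have [w Sw wv0] := VS _ Vv0; exists w; rewrite /= wv0.
  exists (c + m) => // v Vv; have [w Sw wv] := VS _ Vv.
  by rewrite -wv lerD2l mP //= wv.
apply: nS; exists (fun u => g u - c) => [u v uv|u]; first by rewrite ltrD2r g_incr.
by have [w Sw <-] := gS u; rewrite addrAC subrr add0r.
Qed.

(** An embedding of omega ^ h into the union colours each point by membership of its image in [S]; a
    monochromatic copy embeds in [S] or in [S']. *)
Lemma order_type_belowU (h : nat) (R : realType) (S S' : set R) :
  order_type_below _ (omega_exp h) R S ->
  order_type_below _ (omega_exp h) R S' ->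
  order_type_below _ (omega_exp h) R (S `|` S').
Proof.
move=> [wS nS] [wS' nS']; split=> [V VS V0|[g g_incr gS]].
  have [VS0|/set0P VS0] := eqVneq (V `&` S) set0.
    apply: wS' => // v Vv; have [Sv|//] := VS _ Vv.
    by have : (V `&` S) v by []; rewrite VS0.
  have [VS'0|/set0P VS'0] := eqVneq (V `&` S') set0.
    apply: wS => // v Vv; have [//|Sv] := VS _ Vv.
    by have : (V `&` S') v by []; rewrite VS'0.
  have [m [Vm Sm] mP] := wS _ (@subIsetr _ V S) VS0.
  have [m' [Vm' Sm'] m'P] := wS' _ (@subIsetr _ V S') VS'0.
  exists (Num.min m m'); first by rewrite /Num.min; case: ifP.
  move=> v Vv; rewrite ge_min; have [Sv|Sv] := VS _ Vv.
    by rewrite (mP v (conj Vv Sv)).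
  by rewrite (m'P v (conj Vv Sv)) orbT.
have [[] [phi phi_incr phiP]] := omega_exp_indivisible h (g @^-1` S).
  apply: nS; exists (g \o phi) => [u v uv|u]; last exact/asboolP/phiP.
  by rewrite /= g_incr ?phi_incr.
apply: nS'; exists (g \o phi) => [u v uv|u]; first by rewrite /= g_incr ?phi_incr.
by have [Sg|//] := gS (phi u); have /asboolPn := negbT (phiP u).
Qed.

Lemma order_type_below_bigcup (h : nat) (R : realType) (F : nat -> set R)
    (N : nat) :
  (forall i, order_type_below _ (omega_exp h) R (F i)) ->
  order_type_below _ (omega_exp h) R (\bigcup_(i in `I_N) F i).
Proof.
move=> FP; elim: N => [|N IH].
  rewrite II0 bigcup_set0; split=> [V V0 [v /V0]//|[g _ gS]].
  by have [u] := omega_exp_inhabited h; apply: (gS u).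
rewrite IIS bigcup_setU bigcup_set1.
exact: order_type_belowU.
Qed.

Lemma well_ordered_local (R : realType) (S : set R) :
  (forall s, S s -> well_ordered R (S `&` [set z | z < s])) ->
  well_ordered R S.
Proof.
move=> wS V VS [s Vs].
have [V0|/set0P V0] := eqVneq (V `&` [set z | z < s]) set0.
  exists s => // v Vv; rewrite leNgt; apply/negP => vs.
  by have : (V `&` [set z | z < s]) v by []; rewrite V0.
have [|m [Vm ms] mP] := wS s (VS _ Vs) _ _ V0.
  by move=> v [/VS Sv vs].
exists m => // v Vv; have [sv|vs] := leP s v; last exact: mP.
exact: le_trans (ltW ms) sv.
Qed.

(* The isomorphism is the recursive enumeration of S: u is sent to the least
   element of S lying above all the g v with v < u. *)
Lemma has_order_type_of_embeds (R : realType) (d : Order.disp_t)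
    (T : orderType d) (S : set R) :
  well_founded (fun u v : T => (u < v)%O) -> well_ordered R S ->
  embeds d T R S ->
  (forall s, S s -> ~ embeds d T R (S `&` [set z | z < s])) ->
  has_order_type S T.
Proof.
move=> wT wS [e e_incr eS] nS.
(* The default 0 is never taken: by [g_le] below, [e u] is always an admissible candidate. *)
pose F (u : T) (rec : forall v : T, (v < u)%O -> R) : R := xget 0 [set z |
  [/\ S z, forall v (vu : (v < u)%O), rec v vu < z &
  forall w, S w -> (forall v (vu : (v < u)%O), rec v vu < w) -> z <= w]].
pose g := Fix wT (fun=> R) F.
have gE u : g u = F u (fun v _ => g v).
  apply: (Fix_eq wT (fun=> R) F) => w f f' ff'; congr F.
  by apply: functional_extensionality_dep => v; apply: functional_extensionality_dep.
have g_least u w : S w -> (forall v, (v < u)%O -> g v < w) ->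
    [/\ S (g u), forall v, (v < u)%O -> g v < g u & g u <= w].
  move=> Sw wP; rewrite gE /F.
  set Q := (X in xget _ X).
  have /(xgetPex 0) [] : exists z, Q z.
    have [||m [Sm mP] mle] :=
      wS [set z | S z /\ forall v, (v < u)%O -> g v < z].
    - by move=> z [].
    - by exists w.
    - by exists m; split=> // z Sz zP; apply: mle.
  by move=> S1 S2 S3; split => //; apply: S3.
have g_le u : g u <= e u.
  elim/(well_founded_ind wT): u => u IH.
  have [//||//] := g_least u (e u).
  by move=> v vu; apply: le_lt_trans (IH _ vu) (e_incr _ _ vu).
have gP u : S (g u) /\ forall v, (v < u)%O -> g v < g u.
  have [//||//] := g_least u (e u).
  by move=> v vu; apply: le_lt_trans (g_le v) (e_incr _ _ vu).
exists g; first by apply: le_mono => u v uv; apply: (gP v).2.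
apply/seteqP; split=> [_ [u _ <-]|s Ss]; first exact: (gP u).1.
(* If [s] is missed, induction keeps every [g u] below [s], so [T] embeds below [s]. *)
apply: contrapT => ns; apply: (nS s Ss); exists g => [u v uv|u].
  exact: (gP v).2.
split; first exact: (gP u).1.
elim/(well_founded_ind wT): u => u IH /=.
have [_ _] := g_least u s Ss IH.
rewrite le_eqVlt => /orP[/eqP gus|//].
by exfalso; apply: ns; exists u.
Qed.

(** * Reduction mod 1 and sumsets *)

Lemma mod1_itv (R : realType) (z : R) : 0 <= mod1 z < 1.
Proof. by have := floor_itv z; rewrite /mod1 intrD; lra. Qed.

Lemma mod1_eq (R : realType) (z r : R) (k : int) :
  z = k%:~R + r -> 0 <= r < 1 -> mod1 z = r.
Proof.
move=> -> r01; rewrite /mod1 (@floor_def _ _ k); last by rewrite intrD; lra.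
by rewrite addrAC subrr add0r.
Qed.

Lemma mod1D (R : realType) (z w : R) :
  mod1 (z + w) = mod1 z + mod1 w \/ mod1 (z + w) = mod1 z - 1 + mod1 w.
Proof.
have := mod1_itv R z; have := mod1_itv R w.
have [lt1 ? ?|ge1 ? ?] := ltP (mod1 z + mod1 w) 1; [left|right].
  apply: (@mod1_eq _ _ _ (Num.floor z + Num.floor w)); last by lra.
  by rewrite intrD /mod1; lra.
apply: (@mod1_eq _ _ _ (Num.floor z + Num.floor w + 1)); last by lra.
by rewrite !intrD /mod1; lra.
Qed.

(** The distances [t j] of the residues to 1 are positive and add up to less than [delta], hence to
    less than 1. The sum is thus an integer minus a number in (0, 1), and its residue is 1 minus
    that number. *)
Lemma mod1_sum_gt (R : realType) (x delta : R) (h : nat) (b : 'I_h.+1 -> nat) :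
  delta <= 1 ->
  (forall j, 1 - delta / h.+1%:R < mod1 (x * (b j)%:R)) ->
  1 - delta < mod1 (x * (\sum_j b j)%:R).
Proof.
move=> delta1 bP.
pose t j := 1 - mod1 (x * (b j)%:R).
have t_lt : \sum_j t j < delta.
  have -> : delta = \sum_(j < h.+1) delta / h.+1%:R.
    by rewrite sumr_const card_ord -[RHS]mulr_natr divfK // pnatr_eq0.
  apply: ltr_sum => [|j _]; last by rewrite /t ltrBlDr -ltrBlDl.
  by apply/hasP; exists ord0; rewrite // mem_index_enum.
have t_gt0 j : 0 < t j by have := mod1_itv R (x * (b j)%:R); rewrite /t; lra.
have sum_gt0 : 0 < \sum_j t j.
  by rewrite big_ord_recl ltr_pwDl // sumr_ge0 // => j _; apply: ltW.
have xE : x * (\sum_j b j)%:R =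
    (\sum_j (Num.floor (x * (b j)%:R) + 1))%:~R - \sum_j t j.
  rewrite natr_sum mulr_sumr rmorph_sum -sumrB.
  by apply: eq_bigr => j _; rewrite /= intrD /t /mod1; lra.
rewrite (@mod1_eq _ _ (1 - \sum_j t j)
  (\sum_j (Num.floor (x * (b j)%:R) + 1) - 1)); first by lra.
  by rewrite xE intrB; lra.
by lra.
Qed.

Lemma hfold_sumset0 (A : set nat) : hfold_sumset 0 A = [set 0%N].
Proof.
apply/seteqP; split=> [_ [b _ <-]|_ ->]; first by rewrite /= big_ord0.
by exists (fun=> 0%N) => [[]//|]; rewrite big_ord0.
Qed.

Lemma hfold_sumsetS (A : set nat) (h p s : nat) :
  A p -> hfold_sumset h A s -> hfold_sumset h.+1 A (p + s)%N.
Proof.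
move=> Ap [b bA <-].
exists (fun i => oapp b p (unlift ord0 i)) => [i|]; first by case: unliftP => [j|] _; [apply: bA|].
rewrite big_ord_recl unlift_none /=; congr addn.
by apply: eq_bigr => i _; rewrite liftK.
Qed.

Lemma dilate_lt1 (R : realType) (x : R) (S : set nat) (z : R) :
  dilate_mod1 x S z -> 0 <= z < 1.
Proof. by move=> [s _ <-]; apply: mod1_itv. Qed.

(** * Upper bound on the order type *)

Lemma dilate_hfold_below (R : realType) (x : R) (a : nat -> nat) (h : nat)
    (c : R) :
  (fun i : nat => mod1 (x * (a i)%:R)) @ \oo --> (1 : R) -> c < 1 ->
  exists N, dilate_mod1 x (hfold_sumset h.+1 (range a)) `&` [set z | z < c]
    `<=` \bigcup_(i in `I_N)
      ([set mod1 (x * (a i)%:R) + z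
         | z in dilate_mod1 x (hfold_sumset h (range a))] `|`
       [set mod1 (x * (a i)%:R) - 1 + z
         | z in dilate_mod1 x (hfold_sumset h (range a))]).
Proof.
(* The case c <= 0 is separate because [mod1_sum_gt] is applied with [delta] = 1 - c, which must be
   at most 1. *)
move=> ax_cvg c1; have [c_le0|c_gt0] := leP c 0.
  by exists 0%N => z [/dilate_lt1 ? /= ?]; lra.
have [N _ NP] : \forall i \near \oo, 1 - (1 - c) / h.+1%:R < mod1 (x * (a i)%:R).
  apply: (cvgr_gt _ ax_cvg); rewrite ltrBlDr ltrDl divr_gt0 ?ltr0n //; lra.
exists N => _ [[_ [b bA <-] <-] /= zc].
have [k kP] := choice (fun j => let: ex_intro2 i _ e := bA j in
  ex_intro (fun i => a i = b j) i e).
(* If all indices were at least N, every term would be so close to 1 that the sum would exceed c. *)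
have [j jN] : exists j, (k j < N)%N.
  apply: contrapT => /forallNP nj.
  have : 1 - (1 - c) < mod1 (x * (\sum_j b j)%:R).
    apply: mod1_sum_gt => [|j]; first by lra.
    by rewrite -kP; apply: NP; rewrite /= leqNgt; apply/negP/nj.
  by lra.
exists (k j) => //; rewrite kP (bigD1_ord j) //= natrD mulrDr.
set s := (\sum_i b _)%N.
have sP : dilate_mod1 x (hfold_sumset h (range a)) (mod1 (x * s%:R)).
  by exists s => //; exists (b \o lift j) => // i; apply: bA.
by have [->|->] := mod1D R (x * (b j)%:R) (x * s%:R); [left|right];
  exists (mod1 (x * s%:R)).
Qed.

Lemma dilate_hfold_initial_segment (R : realType) (x : R) (a : nat -> nat)
    (h : nat) (c : R) :
  (fun i : nat => mod1 (x * (a i)%:R)) @ \oo --> (1 : R) ->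
  order_type_below _ (omega_exp h.+1) R
    (dilate_mod1 x (hfold_sumset h (range a))) ->
  c < 1 -> order_type_below _ (omega_exp h.+1) R
    (dilate_mod1 x (hfold_sumset h.+1 (range a)) `&` [set z | z < c]).
Proof.
move=> ax_cvg X_below c1.
have [N /order_type_below_subset] := dilate_hfold_below R x a h c ax_cvg c1.
apply; apply: order_type_below_bigcup => i.
by apply: order_type_belowU; apply: order_type_below_translate.
Qed.

Lemma dilate_hfold_order_type_below (R : realType) (x : R) (a : nat -> nat) :
  (fun i : nat => mod1 (x * (a i)%:R)) @ \oo --> (1 : R) ->
  forall h : nat, order_type_below _ (omega_exp h.+1) R
    (dilate_mod1 x (hfold_sumset h (range a))).
Proof.
move=> ax_cvg; elim=> [|h IH].
  have X0 z : dilate_mod1 x (hfold_sumset 0 (range a)) z -> z = mod1 (x * 0).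
    by rewrite hfold_sumset0 => -[_ -> <-].
  split=> [V VS [v Vv]|[g g_incr gS]].
    by exists v => // w /VS/X0 ->; rewrite (X0 _ (VS _ Vv)).
  have : g ((0%N, ord0 : 'I_1) : omega_exp 1) < g ((1%N, ord0 : 'I_1) : omega_exp 1).
    by apply: g_incr; rewrite omega_exp_lt.
  by rewrite (X0 _ (gS _)) (X0 _ (gS (1%N, _))) ltxx.
have below c := dilate_hfold_initial_segment R x a h c ax_cvg IH.
split=> [|[g g_incr gS]].
  by apply: well_ordered_local => s /dilate_lt1/andP[_ /below[]].
have [u] := omega_exp_inhabited h.+1.
(* All of the first copy of omega ^ (h + 1) is sent below the image of (1, u), which is less than 1;
   this contradicts the bound on initial segments. *)
have /andP[_ /below[_]] := dilate_lt1 _ _ _ _ (gS (1%N, u)).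
apply; exists (fun v => g ((0%N, v) : omega_exp h.+2)) => [v w vw|v].
  by apply: g_incr; rewrite omega_exp_lt eqxx vw orbT.
by split=> //=; apply: g_incr; rewrite omega_exp_lt.
Qed.

(** * Lower bound on the order type *)

(* sigma u is the total distance to 1 of the values of the terms of b u.  The
   pair (n, u) is sent to a (N + n + 1) plus a sum whose sigma is less than the
   gap between the distances of a (N + n) and a (N + n + 1). *)
Lemma small_sums (R : realType) (x : R) (a : nat -> nat) :
  {homo (fun i => mod1 (x * (a i)%:R)) : i j / (i < j)%N >-> i < j} ->
  (fun i : nat => mod1 (x * (a i)%:R)) @ \oo --> (1 : R) ->
  forall (h : nat) (eps : R), 0 < eps ->
  exists b : omega_exp h -> nat, exists sigma : omega_exp h -> R,
    [/\ forall u, hfold_sumset h (range a) (b u),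
        forall u, exists k : int, x * (b u)%:R = k%:~R - sigma u,
        forall u, 0 <= sigma u < eps /\ ((0 < h)%N -> 0 < sigma u) &
        {homo sigma : u v / (u < v)%O >-> v < u}].
Proof.
move=> ax_incr ax_cvg; elim=> [|h IH] eps eps_gt0.
  (* The empty sum has distance 0, which is why positivity is claimed only for 0 < h. *)
  exists (fun=> 0%N), (fun=> 0); split.
  - by move=> u; rewrite hfold_sumset0.
  - by move=> u; exists 0; rewrite mulr0 subr0.
  - by move=> u; rewrite lexx.
  - by move=> u v; rewrite (ord1 u) (ord1 v) ltxx.
pose t i := 1 - mod1 (x * (a i)%:R).
have t_gt0 i : 0 < t i by have := mod1_itv R (x * (a i)%:R); rewrite /t; lra.
have t_decr i j : (i < j)%N -> t j < t i by move=> /ax_incr; rewrite /t; lra.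
have [N _ NP] : \forall i \near \oo, 1 - eps < mod1 (x * (a i)%:R).
  by apply: (cvgr_gt _ ax_cvg); lra.
have tN : t N < eps by have := NP N (leqnn N); rewrite /t /=; lra.
have gap n : 0 < t (N + n)%N - t (N + n).+1 by rewrite subr_gt0 t_decr.
have [b /choice[sigma bsP]] := choice (fun n => IH _ (gap n)).
exists (fun nu => (a (N + nu.1).+1 + b nu.1 nu.2)%N).
exists (fun nu => t (N + nu.1).+1 + sigma nu.1 nu.2); split.
- move=> [n u]; have [bA _ _ _] := bsP n.
  by apply: hfold_sumsetS => //; exists (N + n).+1.
- move=> [n u] /=; have [_ /(_ u)[k kP] _ _] := bsP n.
  exists (Num.floor (x * (a (N + n).+1)%:R) + 1 + k).
  by rewrite natrD mulrDr kP !intrD /t /mod1; lra.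
- move=> [n u] /=; have [_ _ /(_ u)[s_itv _] _] := bsP n.
  have := t_gt0 (N + n).+1.
  have : t (N + n)%N <= t N.
    by have [->|n_gt0] := posnP n; rewrite ?addn0 // ltW // t_decr // -addn1 leq_add2l.
  by split=> [|_]; lra.
- move=> [n u] [m v]; rewrite omega_exp_lt => /orP[lt_nm|/andP[/eqP<- lt_uv]] /=.
    have [_ _ /(_ v)[v_itv _] _] := bsP m.
    have [_ _ /(_ u)[u_itv _] _] := bsP n.
    (* The gap bound gives t (N + m + 1) + sigma m v < t (N + m), while the value at (n, u) is at
       least t (N + n + 1). *)
    have : t (N + m)%N <= t (N + n).+1.
      move: lt_nm; rewrite leq_eqVlt => /orP[/eqP<-|lt_nm]; first by rewrite addnS.
      by rewrite ltW // t_decr // -addnS ltn_add2l.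
    by lra.
  have [_ _ _ s_decr] := bsP n.
  by rewrite ltrD2l s_decr.
Qed.

(** * Irrationality and conclusion *)

(** Equal residues for n != m would make x a quotient of integers. This upgrades the monotonicity of
    the sequence to strict monotonicity. *)
Lemma mod1_mulr_inj (R : realType) (x : R) :
  irrational x -> injective (fun n : nat => mod1 (x * n%:R)).
Proof.
move=> x_irr n m; rewrite /mod1 => nm.
apply/eqP; apply: contrapT => /negP neq_nm; apply: x_irr.
set k := Num.floor (x * n%:R) in nm; set l := Num.floor (x * m%:R) in nm.
have nm0 : (n%:Z - m%:Z)%:~R != 0 :> R by rewrite intr_eq0 subr_eq0.
exists ((k - l)%:~R / (n%:Z - m%:Z)%:~R) => //.
rewrite fmorph_div /= !ratr_int; apply: (mulIf nm0).
by rewrite divfK // !intrB -!pmulrn; lra.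
Qed.

Theorem theorem2 (R : realType) (x : R) (a : nat -> nat)
    (x_irr : irrational x)
    (a_incr : forall i j : nat, (i < j)%N -> (a i < a j)%N)
    (ax_incr : nondecreasing_seq (fun i : nat => mod1 (x * (a i)%:R)))
    (ax_cvg : (fun i : nat => mod1 (x * (a i)%:R)) @ \oo --> (1 : R))
    (h : nat) (h_gt0 : (0 < h)%N) :
  has_order_type (dilate_mod1 x (hfold_sumset h (range a))) (omega_exp h).
Proof.
have ax_sincr :
    {homo (fun i => mod1 (x * (a i)%:R)) : i j / (i < j)%N >-> i < j}.
  move=> i j ij; rewrite lt_neqAle ax_incr ?andbT; last exact: ltnW.
  by apply/eqP => /(mod1_mulr_inj R x x_irr) /eqP; rewrite ltn_eqF ?a_incr.
have [wX _] := dilate_hfold_order_type_below R x a ax_cvg h.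
apply: has_order_type_of_embeds => [|//| |]; [exact: omega_exp_wf| |].
  (* With [eps] = 1, each [sigma w] lies in (0, 1), so the residue is exactly 1 - [sigma w] and
     increases with w. *)
  have [b [sigma [bA bk sP s_decr]]] := small_sums R x a ax_sincr ax_cvg h 1 ltr01.
  exists (fun u => mod1 (x * (b u)%:R)) => [u v uv|u]; last by exists (b u).
  have mE w : mod1 (x * (b w)%:R) = 1 - sigma w.
    have [k kP] := bk w; have [s_itv /(_ h_gt0) s_gt0] := sP w.
    by apply: (@mod1_eq _ _ _ (k - 1)); rewrite ?intrB ?kP; lra.
  by rewrite !mE ltrD2l ltrN2 s_decr.
(* The sharp bound on proper initial segments comes from one summand fewer: writing h + 1 for the
   exponent, X_h has type < omega ^ (h + 1), hence so has the part of X_{h+1} below s < 1. *)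
case: h h_gt0 {wX} => // h _ s /dilate_lt1/andP[_ s1].
apply: (dilate_hfold_initial_segment R x a h s ax_cvg _ s1).2.
exact: dilate_hfold_order_type_below.
Qed.
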